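(* For every positive integer $k$ and every constant $\varepsilon>0$, there is no polynomial time algorithm (in the value and independence oracle model) for maximizing a non-negative monotone submodular function over a $k$-extendible system that achieves an approximation ratio of $(1-e^{-1/k})^{-1}-\varepsilon$.
   Context: An independence system on a finite ground set $\mathcal{N}$ of size $n$ is a non-empty family $\mathcal{I}\subseteq2^{\mathcal{N}}$ closed under subsets; it is $k$-extendible if for all $A\subseteq B\in\mathcal{I}$ and $u\notin B$ with $A\cup\{u\}\in\mathcal{I}$ there is $Y\subseteq B\setminus A$, $|Y|\le k$, with $(B\setminus Y)\cup\{u\}\in\mathcal{I}$. $f:2^{\mathcal{N}}\to\mathbb{R}_{\ge0}$ is submodular if $f(X\cup Y)+f(X\cap Y)\le f(X)+f(Y)$ and monotone if $f(A)\le f(B)$ for $A\subseteq B$. The algorithm accesses $f$ only through a value oracle and $\mathcal{I}$ only through an independence oracle; ''polynomial time'' means polynomially many (in $n$) oracle queries; the algorithm may be randomized. An approximation ratio of $\alpha$ means the (expected) value of the output independent set is at least $f(OPT)/\alpha$ on every instance, where $OPT$ maximizes $f$ over $\mathcal{I}$. The hardness is information-theoretic. *)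

(* Defs.v *)
From HB Require Import structures.
From mathcomp Require Import all_boot all_order all_algebra.
From mathcomp Require Import all_classical all_reals all_analysis.

Set Implicit Arguments.
Unset Strict Implicit.
Unset Printing Implicit Defensive.

Import Order.TTheory GRing.Theory Num.Theory.

Local Open Scope ring_scope.

Section Problem.
Variables (R : realType) (T : finType).
Implicit Types (I : {set {set T}}) (f : {set T} -> R).

Definition independence_system I : Prop :=
  (exists A, A \in I) /\
  (forall A B : {set T}, A \subset B -> B \in I -> A \in I).

Definition extendible_system (k : nat) I : Prop :=
  independence_system I /\
  forall (A B : {set T}) (u : T),
    A \subset B -> B \in I -> u \notin B -> A :|: [set u]%SET \in I ->
    exists Y : {set T},
      [/\ Y \subset B :\: A, (#|Y| <= k)%N
        & (B :\: Y) :|: [set u]%SET \in I].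

Definition nonneg_setfun f : Prop := forall X, 0 <= f X.

Definition submodular f : Prop :=
  forall X Y : {set T}, f (X :|: Y) + f (X :&: Y) <= f X + f Y.

Definition monotone_setfun f : Prop :=
  forall A B : {set T}, A \subset B -> f A <= f B.

Definition valid_instance (k : nat) f I : Prop :=
  [/\ nonneg_setfun f, monotone_setfun f, submodular f
    & extendible_system k I].

Definition is_opt f I (O : {set T}) : Prop :=
  O \in I /\ forall S : {set T}, S \in I -> f S <= f O.

(* A deterministic algorithm is an adaptive decision tree: computation between
   queries is free, so that only oracle calls are counted. *)
Inductive oracle_tree : Type :=
| Output of {set T}
| ValueQuery of {set T} & (R -> oracle_tree)
| IndepQuery of {set T} & (bool -> oracle_tree).

Fixpoint run (t : oracle_tree) f I : {set T} :=
  match t with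
  | Output X => X
  | ValueQuery X next => run (next (f X)) f I
  | IndepQuery X next => run (next (X \in I)) f I
  end.

Fixpoint query_count (t : oracle_tree) f I : nat :=
  match t with
  | Output _ => 0%N
  | ValueQuery X next => (query_count (next (f X)) f I).+1
  | IndepQuery X next => (query_count (next (X \in I)) f I).+1
  end.

(* The random bits are drawn in advance from an arbitrary probability space;
   the output, which ranges over the finite type {set T}, has to be a random
   variable whatever the oracles are. *)
Record rand_algorithm : Type := RandAlgorithm {
  seed_display : measure_display;
  seed : measurableType seed_display;
  seed_law : probability seed R;
  strategy : seed -> oracle_tree;
  measurable_run : forall f I (S : {set T}),
        measurable [set w | run (strategy w) f I = S]%classic
}.

Definition expected_value (A : rand_algorithm) f I : \bar R :=
  expectation (seed_law A) (fun w => f (run (@strategy A w) f I)).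

End Problem.

(* The algorithm may depend on the size n of the ground set, which is taken to
   be 'I_n. *)
Definition algorithm (R : realType) : Type := forall n, rand_algorithm R 'I_n.

Definition polynomial_queries (R : realType) (k : nat) (A : algorithm R) :
    Prop :=
  exists p : {poly nat},
    forall n (f : {set 'I_n} -> R) (I : {set {set 'I_n}}),
      valid_instance k f I ->
      forall w : seed (A n), (query_count (strategy w) f I <= p.[n])%N.

Definition outputs_independent (R : realType) (k : nat) (A : algorithm R) :
    Prop :=
  forall n (f : {set 'I_n} -> R) (I : {set {set 'I_n}}),
    valid_instance k f I ->
    forall w : seed (A n), run (strategy w) f I \in I.

(* Positivity of alpha is required because f OPT / alpha would be at most 0
   otherwise, a bound which every algorithm meets. *)
Definition approximation_ratio (R : realType) (k : nat) (A : algorithm R)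
    (alpha : R) : Prop :=
  0 < alpha /\
  forall n (f : {set 'I_n} -> R) (I : {set {set 'I_n}}),
    valid_instance k f I ->
    forall OPT : {set 'I_n}, is_opt f I OPT ->
      ((f OPT / alpha)%:E <= expected_value (A n) f I)%E.

(* Main.v *)
(* The ground set is split into M blocks of h elements, and a hidden set H picks
   one element at random from each block. With x = |S :&: H|, y = |S :\: H| and
   a threshold t that is a small fraction of M, the elements of H beyond the
   first t cost only 1/k in the constraint
     y + min(x, t) + max(x - t, 0) / k <= m,   where m is about M / k,
   and the objective is 1 - max(eta, rho^(y + min(x, t)) (1 - (1 - rho)
   max(x - t, 0))) with rho = exp(- 1 / M). Then H is feasible with value close
   to 1. A fixed set X satisfies x <= |X| / h + t / 2 outside an event of
   exponentially small probability; X then has x <= t, or is so large that the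
   objective is truncated and X is infeasible, and in both cases the oracles
   answer as if H were empty. Against those answers a feasible set has at most m
   elements and value at most 1 - exp(- m / M), which is about 1 - exp(- 1 / k).
   Averaging over H contradicts the approximation ratio. *)
Require Import Defs.
From mathcomp Require Import all_boot all_order all_algebra.
From mathcomp Require Import all_classical all_reals all_analysis.
From mathcomp Require Import measurable_realfun fintype finset zify ring lra.

Set Implicit Arguments.
Unset Strict Implicit.
Unset Printing Implicit Defensive.

Import Order.TTheory GRing.Theory Num.Theory.

Local Open Scope ring_scope.

(** * Supermodularity from convexity, and for products *)

Lemma convex_seq_supermodular (R : realType) (a : nat -> R) (i p q : nat) :
  (forall n, a n.+1 - a n <= a n.+2 - a n.+1) ->
  a (i + p)%N + a (i + q)%N <= a i + a (i + p + q)%N.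
Proof.
move=> a_convex.
have slope_homo n d : a n.+1 - a n <= a (n + d).+1 - a (n + d)%N.
  elim: d => [|d IHd]; first by rewrite addn0.
  by rewrite addnS (le_trans IHd).
elim: q => [|q IHq]; first by rewrite !addn0 addrC.
have := slope_homo (i + q)%N p.
rewrite (_ : i + q + p = i + p + q)%N; last by lia.
by rewrite !addnS; lra.
Qed.

(** With [u1 + u2 - uU] and [v1 + v2 - vU] as intermediate points, the right side minus the left is
    exactly the sum of the products in [le1] to [le4]. *)
Lemma antimono_supermodular_mul (R : realDomainType)
    (uU u1 u2 uI vU v1 v2 vI : R) :
  0 <= uU -> 0 <= vU ->
  uU <= u1 -> uU <= u2 -> vU <= v1 -> vU <= v2 ->
  u1 <= uI -> u2 <= uI -> v1 <= vI -> v2 <= vI ->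
  u1 + u2 <= uU + uI -> v1 + v2 <= vU + vI ->
  u1 * v1 + u2 * v2 <= uU * vU + uI * vI.
Proof.
move=> uU0 vU0 uU1 uU2 vU1 vU2 uI1 uI2 vI1 vI2 u_sup v_sup.
have le1 : 0 <= (u1 - uU) * (v2 - vU) by rewrite mulr_ge0 ?subr_ge0.
have le2 : 0 <= (u2 - uU) * (v1 - vU) by rewrite mulr_ge0 ?subr_ge0.
have le3 : 0 <= (uI - (u1 + u2 - uU)) * vI.
  by apply: mulr_ge0; lra.
have le4 : 0 <= (u1 + u2 - uU) * (vI - (v1 + v2 - vU)).
  by apply: mulr_ge0; lra.
by nra.
Qed.

(** * The instance with a hidden set *)

Section HiddenInstance.
Variables (R : realType) (T : finType).
Variables (rho eta : R) (k t m : nat).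
Implicit Types (H S X Y : {set T}).

(** The powers of [rho] up to [t], then the line through their points at [t] and [t + 1], which
    keeps the sequence convex. *)
Definition decay (x : nat) : R := rho ^+ minn x t * (1 - (1 - rho) *+ (x - t)).

Definition residual H S : R := decay #|S :&: H| * rho ^+ #|S :\: H|.

Definition hidden_value H S : R := 1 - Num.max eta (residual H S).

(** The constraint is multiplied by [k] to stay in the natural numbers. *)
Definition hidden_weight H S : nat :=
  (k * (#|S :\: H| + minn #|S :&: H| t) + (#|S :&: H| - t))%N.

Definition hidden_system H : {set {set T}} :=
  [set S : {set T} | (hidden_weight H S <= k * m)%N]%SET.

Hypotheses (k_gt0 : (0 < k)%N) (rho_ge0 : 0 <= rho) (rho_le1 : rho <= 1).
Hypotheses (eta_ge0 : 0 <= eta) (eta_le1 : eta <= 1).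

Lemma decay_small x : (x <= t)%N -> decay x = rho ^+ x.
Proof.
move=> xt; rewrite /decay (minn_idPl xt).
by move: xt; rewrite -subn_eq0 => /eqP ->; rewrite mulr0n subr0 mulr1.
Qed.

(** In this form the decrements are visibly nonnegative and nonincreasing, which yields monotonicity
    and convexity. *)
Lemma decayS x : decay x.+1 = decay x - (1 - rho) * rho ^+ minn x t.
Proof.
rewrite /decay; case: (leqP t x) => [tx|xt].
  rewrite (minn_idPr _) ?(leqW tx)// subSn// mulrSr; ring.
rewrite (minn_idPl xt) (_ : (x.+1 - t = 0)%N); last by lia.
by rewrite (_ : (x - t = 0)%N) ?exprS ?mulr0n; [ring|lia].
Qed.

Lemma decay_antimono x y : (x <= y)%N -> decay y <= decay x.
Proof.
move/subnKC <-; elim: (y - x)%N => [|d IHd]; first by rewrite addn0.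
rewrite addnS decayS (le_trans _ IHd)// lerBlDr lerDl.
by rewrite mulr_ge0 ?exprn_ge0 ?subr_ge0.
Qed.

Lemma decay_le1 x : decay x <= 1.
Proof. by rewrite (le_trans (decay_antimono (leq0n x)))// decay_small. Qed.

Lemma decay_convex x : decay x.+1 - decay x <= decay x.+2 - decay x.+1.
Proof.
rewrite !decayS.
have : rho ^+ minn x.+1 t <= rho ^+ minn x t.
  by apply: ler_wiXn2l => //; lia.
have : 0 <= 1 - rho by rewrite subr_ge0.
by nra.
Qed.

Lemma expr_antimono x y : (x <= y)%N -> rho ^+ y <= rho ^+ x.
Proof. by move=> xy; apply: ler_wiXn2l. Qed.

Lemma expr_convex x : rho ^+ x.+1 - rho ^+ x <= rho ^+ x.+2 - rho ^+ x.+1.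
Proof.
rewrite !exprS.
have := mulr_ge0 (sqr_ge0 (1 - rho)) (exprn_ge0 x rho_ge0).
by nra.
Qed.

(** Union and intersection have the same total size as [X] and [Y] but are further apart in size, so
    convexity favours them. *)
Lemma card_supermodular (a : nat -> R) (X Y : {set T}) :
  (forall n, a n.+1 - a n <= a n.+2 - a n.+1) ->
  a #|X| + a #|Y| <= a #|X :|: Y| + a #|X :&: Y|.
Proof.
move=> a_convex; have := cardsUI X Y.
have := subset_leq_card (subsetIl X Y); have := subset_leq_card (subsetIr X Y).
move=> iY iX UI.
have := convex_seq_supermodular #|X :&: Y| (#|X| - #|X :&: Y|)
  (#|Y| - #|X :&: Y|) a_convex.
rewrite !subnKC// (_ : #|X| + (_ - _) = #|X :|: Y|)%N; last by lia.
by rewrite [X in _ <= X]addrC.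
Qed.

Section Value.
Variable H : {set T}.
Hypothesis H_small : (1 - rho) *+ #|H| <= 1.

(** Past the threshold the linear factor could turn negative; [H_small] excludes this up to [#|H|],
    which covers every [#|S :&: H|]. *)
Lemma decay_ge0 x : (x <= #|H|)%N -> 0 <= decay x.
Proof.
move=> xH; rewrite /decay mulr_ge0 ?exprn_ge0// subr_ge0.
apply: le_trans H_small; apply: ler_wpMn2l; first by rewrite subr_ge0.
by lia.
Qed.

Lemma decay_capH_ge0 S : 0 <= decay #|S :&: H|.
Proof. by rewrite decay_ge0// subset_leq_card// subsetIr. Qed.

Lemma residual_antimono X Y : X \subset Y -> residual H Y <= residual H X.
Proof.
move=> XY; rewrite ler_pM ?exprn_ge0 ?decay_capH_ge0//.
- by rewrite decay_antimono// subset_leq_card// setSI.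
- by rewrite expr_antimono// subset_leq_card// setSD.
Qed.

Lemma residual_supermodular X Y :
  residual H X + residual H Y <= residual H (X :|: Y) + residual H (X :&: Y).
Proof.
have capU : ((X :|: Y) :&: H = (X :&: H) :|: (Y :&: H)) by rewrite setIUl.
have capI : ((X :&: Y) :&: H = (X :&: H) :&: (Y :&: H)).
  by rewrite setIIl.
have diffU : ((X :|: Y) :\: H = (X :\: H) :|: (Y :\: H)) by rewrite setDUl.
have diffI : ((X :&: Y) :\: H = (X :\: H) :&: (Y :\: H)) by rewrite setDIl.
apply: antimono_supermodular_mul;
  rewrite ?decay_capH_ge0 ?exprn_ge0 ?decay_antimono ?expr_antimono//
    ?subset_leq_card ?setSI ?setSD ?subsetUl ?subsetUr ?subsetIl ?subsetIr//.
- by rewrite capU capI; apply: card_supermodular; apply: decay_convex.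
- by rewrite diffU diffI; apply: card_supermodular; apply: expr_convex.
Qed.

Lemma hidden_value_ge0 : nonneg_setfun (hidden_value H).
Proof.
move=> S; rewrite subr_ge0 ge_max eta_le1 /= /residual.
by rewrite mulr_ile1 ?decay_capH_ge0 ?exprn_ge0 ?decay_le1 ?exprn_ile1.
Qed.

Lemma hidden_value_monotone : monotone_setfun (hidden_value H).
Proof.
move=> X Y XY; rewrite lerB// ge_max !le_max lexx /=.
by rewrite (residual_antimono XY) orbT.
Qed.

(** Truncation keeps supermodularity because [residual] is antitone: its values at [X] and [Y] lie
    between those at the union and the intersection, and [eta] is located among the four. *)
Lemma hidden_value_submodular : submodular (hidden_value H).
Proof.
move=> X Y; rewrite /hidden_value.
have := residual_supermodular X Y.
have := residual_antimono (subsetUl X Y).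
have := residual_antimono (subsetUr X Y).
have := residual_antimono (subsetIl X Y).
have := residual_antimono (subsetIr X Y).
move: (residual H X) (residual H Y) (residual H (X :|: Y))
  (residual H (X :&: Y)) => a b u i.
rewrite !maxEle; case: (leP eta a); case: (leP eta b); case: (leP eta u);
  by case: (leP eta i); lra.
Qed.

End Value.

(** * Extendibility of the hidden system *)

Lemma hidden_weight_add H S u :
  u \notin S ->
  (hidden_weight H (S :|: [set u]%SET) <= hidden_weight H S + k)%N.
Proof.
move=> uS; rewrite /hidden_weight setIUl setDUl.
case: (boolP (u \in H)) => uH.
- have -> : ([set u] :&: H = [set u])%SET by apply/setIidPl; rewrite sub1set.
  have -> : ([set u] :\: H = set0)%SET.
    by apply/eqP; rewrite setD_eq0 sub1set.
  rewrite setU0 setUC cardsU1 in_setI (negbTE uS) /=; nia.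
- have -> : ([set u] :\: H = [set u])%SET.
    by apply/setDidPl; rewrite disjoints1.
  have -> : ([set u] :&: H = set0)%SET.
    by apply/disjoint_setI0; rewrite disjoints1.
  rewrite setU0 setUC cardsU1 in_setD (negbTE uS) andbF /=; nia.
Qed.

Lemma hidden_weight_del H S Y :
  Y \subset S -> (hidden_weight H (S :\: Y) + #|Y| <= hidden_weight H S)%N.
Proof.
move=> YS; rewrite /hidden_weight.
have cap : (#|(S :\: Y) :&: H| + #|Y :&: H| = #|S :&: H|)%N.
  rewrite -[RHS](cardsID Y) addnC; congr (_ + _)%N; apply: eq_card => e;
  rewrite !inE; move/subsetP/(_ e): YS;
  by case: (e \in Y); case: (e \in S); case: (e \in H) => //= /(_ isT).
have diff : (#|(S :\: Y) :\: H| + #|Y :\: H| = #|S :\: H|)%N.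
  rewrite -[RHS](cardsID Y) addnC; congr (_ + _)%N; apply: eq_card => e;
  rewrite !inE; move/subsetP/(_ e): YS;
  by case: (e \in Y); case: (e \in S); case: (e \in H) => //= /(_ isT).
rewrite -(cardsID H Y); nia.
Qed.

(** Adding an element costs at most [k] and each deletion regains at least 1, so [k] deletions make
    room for [u]. If [B :\: A] has fewer elements, deleting it leaves [A] with [u]. *)
Lemma hidden_system_extendible H : extendible_system k (hidden_system H).
Proof.
have downward (A B : {set T}) : A \subset B ->
    B \in hidden_system H -> A \in hidden_system H.
  move=> AB; rewrite !inE; apply: leq_trans.
  have -> : A = B :\: (B :\: A).
    by rewrite setDDr setDv set0U (setIidPr AB).
  by apply: leq_trans (hidden_weight_del H (subsetDl B A)); rewrite leq_addr.
split; first split => //.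
  exists set0; rewrite inE /hidden_weight set0I set0D cards0.
  by rewrite min0n addn0 muln0.
move=> A B u AB BI uB AuI.
case: (leqP k #|B :\: A|) => [kBA|kBA]; last first.
  exists (B :\: A); split; rewrite ?(ltnW kBA)//.
  by rewrite setDDr setDv set0U (setIidPr AB).
have [Y YBA Yk] : exists2 Y : {set T}, Y \subset B :\: A & #|Y| = k.
  move: (kBA); rewrite -bin_gt0 -cards_draws card_gt0 => /set0Pn[Y].
  by rewrite inE => /andP[YBA /eqP Yk]; exists Y.
exists Y; split; rewrite ?Yk//.
have YB : Y \subset B := subset_trans YBA (subsetDl B A).
move: BI; rewrite !inE; apply: leq_trans.
apply: leq_trans (hidden_weight_del H YB); rewrite Yk.
by apply: hidden_weight_add; rewrite inE negb_and uB orbT.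
Qed.

Lemma hidden_instance_valid H :
  (1 - rho) *+ #|H| <= 1 ->
  valid_instance k (hidden_value H) (hidden_system H).
Proof.
move=> H_small; split.
- exact: hidden_value_ge0.
- exact: hidden_value_monotone.
- exact: hidden_value_submodular.
- exact: hidden_system_extendible.
Qed.

Lemma hidden_value_le1 H S : hidden_value H S <= 1.
Proof. by rewrite lerBlDr lerDl le_max eta_ge0. Qed.

(** The empty hidden set gives the reference instance, where value and independence depend on [#|S|]
    alone. *)
Lemma residual_set0 S : residual set0 S = rho ^+ #|S|.
Proof.
by rewrite /residual setI0 cards0 setD0 decay_small// mul1r.
Qed.

Lemma mem_hidden_system_set0 S :
  (S \in hidden_system set0) = (#|S| <= m)%N.
Proof.
rewrite inE /hidden_weight setI0 cards0 setD0 min0n addn0 addn0.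
by rewrite leq_pmul2l.
Qed.

(* If S meets H in more than t points although it is far larger than |S :&: H|,
   then both values are truncated and S is dependent in both systems. *)
Lemma hidden_instance_eq_set0 H S :
  ((t < #|S :&: H|)%N -> (m < #|S :\: H|)%N /\ rho ^+ #|S :\: H| <= eta) ->
  hidden_value H S = hidden_value set0 S /\
  (S \in hidden_system H) = (S \in hidden_system set0).
Proof.
move=> S_large; have cS := cardsID H S.
rewrite /hidden_value residual_set0 mem_hidden_system_set0.
case: (leqP #|S :&: H| t) => [xt|/[dup] tx /S_large[mS etaS]].
  split; first by rewrite /residual decay_small// -exprD cS.
  rewrite inE /hidden_weight (minn_idPl xt) (_ : (_ - t = 0)%N); last by lia.
  by rewrite addn0 addnC cS leq_pmul2l.
split.
  have -> : Num.max eta (rho ^+ #|S|) = eta.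
    apply/max_idPl; apply: le_trans etaS; apply: expr_antimono.
    by rewrite subset_leq_card// subsetDl.
  rewrite (_ : Num.max _ _ = eta)//; apply/max_idPl; apply: le_trans etaS.
  by rewrite ler_piMl ?exprn_ge0 ?decay_le1.
rewrite inE [RHS]leqNgt (leq_trans mS) ?subset_leq_card ?subsetDl//=.
by apply/negbTE; rewrite -ltnNge /hidden_weight; nia.
Qed.

End HiddenInstance.

(** * Runs of oracle trees *)

Section OracleTrees.
Variables (R : realType) (T : finType).
Implicit Types (tr : oracle_tree R T) (f : {set T} -> R) (I : {set {set T}}).

Fixpoint queries tr f I : seq {set T} :=
  match tr with
  | Output _ => [::]
  | ValueQuery X next => X :: queries (next (f X)) f I
  | IndepQuery X next => X :: queries (next (X \in I)) f I
  end.

Lemma size_queries tr f I : size (queries tr f I) = query_count tr f I.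
Proof. by elim: tr => //= X next IHnext; rewrite IHnext. Qed.

(** Equal answers select the same branch, so despite adaptivity it suffices to compare the oracles
    on the queries of one run. *)
Lemma eq_run_on_queries tr f I f' I' :
  (forall X, X \in queries tr f I -> f' X = f X /\ (X \in I') = (X \in I)) ->
  run tr f' I' = run tr f I.
Proof.
elim: tr => //= X next IHnext eq_on; have [fX IX] := eq_on X (mem_head _ _).
- by rewrite fX; apply: IHnext => Y Yq; apply: eq_on; rewrite inE Yq orbT.
- by rewrite IX; apply: IHnext => Y Yq; apply: eq_on; rewrite inE Yq orbT.
Qed.

(* Every member of the family that agrees with (f0, I0) on the queries and on
   the output of the run against (f0, I0) makes the algorithm output that very
   set; the others are counted by the union bound. *)
Lemma sum_run_indistinguishable (J : finType) tr f0 I0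
    (f : J -> {set T} -> R) (I : J -> {set {set T}})
    (differ : J -> {set T} -> bool) (v B : R) (q : nat) :
  (forall j X, ~~ differ j X ->
     f j X = f0 X /\ (X \in I j) = (X \in I0)) ->
  (forall X, #|[set j | differ j X]%SET|%:R <= B) ->
  (forall j X, f j X <= 1) -> 0 <= v -> f0 (run tr f0 I0) <= v ->
  (query_count tr f0 I0 <= q)%N ->
  \sum_j f j (run tr (f j) (I j)) <= #|J|%:R * v + (q.+1)%:R * B.
Proof.
move=> agree few_differ f_le1 v_ge0 f0v tr_q.
set S0 := run tr f0 I0 in f0v *.
pose Q := S0 :: queries tr f0 I0.
have B_ge0 : 0 <= B := le_trans (ler0n _ _) (few_differ S0).
(* If some set of [Q] differs, the sum is at least 1 and so bounds [f j]; otherwise both runs output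
   [S0]. *)
have bound j : f j (run tr (f j) (I j)) <= v + \sum_(X <- Q) (differ j X)%:R.
  case: (boolP (has (differ j) Q)) => [/hasP[X XQ dX]|/hasPn same].
    apply: le_trans (f_le1 _ _) _; rewrite (big_rem X)//= dX.
    by rewrite addrCA lerDl addr_ge0// sumr_ge0.
  rewrite (@eq_run_on_queries tr f0 I0); last first.
    by move=> X Xq; apply: agree; apply: same; rewrite inE Xq orbT.
  have [-> _] := agree j S0 (same _ (mem_head _ _)).
  by rewrite (le_trans f0v)// lerDl sumr_ge0.
apply: (le_trans (ler_sum _ (fun j _ => bound j))).
rewrite big_split /= sumr_const -[v *+ _]mulr_natl lerD2l exchange_big /=.
apply: (@le_trans _ _ (\sum_(X <- Q) B)).
  apply: ler_sum => X _; apply: le_trans (few_differ X).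
  rewrite -sum1dep_card natr_sum [leRHS]big_mkcond /=.
  by apply: ler_sum => j _; case: (differ j X).
rewrite big_const_seq count_predT iter_addr_0 -[B *+ _]mulr_natl.
rewrite ler_wpM2r// ler_nat.
by rewrite /= ltnS size_queries.
Qed.

End OracleTrees.

(** * Averaging over the random seed *)

Section Averaging.
Variables (R : realType) (T : finType) (A : rand_algorithm R T).
Implicit Types (f g : {set T} -> R) (I : {set {set T}}).

(** Outputs range over a finite type, so a preimage is a finite union of the events in
    [measurable_run]. *)
Lemma measurable_fun_run f g I :
  measurable_fun classical_sets.setT
    (fun w : seed A => g (run (strategy w) f I)).
Proof.
move=> _ Y mY; rewrite classical_sets.setTI.
rewrite (_ : (_ @^-1` Y)%classic =
    (\bigcup_(S in [set S | Y (g S)])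
       [set w | run (strategy w) f I = S])%classic).
  apply: fin_bigcup_measurable; first exact: finite_finset.
  by move=> S _; apply: measurable_run.
apply/seteqP; split=> w /=; first by move=> Yw; exists (run (strategy w) f I).
by case=> S /= YS run_S; rewrite run_S.
Qed.

(** The easy half of Yao's principle: the sum over instances moves inside the expectation, where it
    is bounded seed by seed. *)
Lemma sum_expected_value_le (J : finType) (f : J -> {set T} -> R)
    (I : J -> {set {set T}}) (B : R) :
  (forall j, nonneg_setfun (f j)) ->
  (forall w : seed A, \sum_j f j (run (strategy w) (f j) (I j)) <= B) ->
  (\sum_j expected_value A (f j) (I j) <= B%:E)%E.
Proof.
move=> f_ge0 f_le; rewrite /expected_value expectation.unlock.
rewrite -ge0_integral_sum//; last 2 first.
- move=> j; apply/measurable_EFinP; exact: measurable_fun_run.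
- by move=> j w _; rewrite lee_fin f_ge0.
apply: (@le_trans _ _ (\int[seed_law A]_(w in classical_sets.setT) (B%:E))%E).
  apply: ge0_le_integral => //.
  - by move=> w _; apply: sume_ge0 => j _; rewrite lee_fin f_ge0.
  - apply: emeasurable_sum => j; apply/measurable_EFinP.
    exact: measurable_fun_run.
  - by move=> w _; rewrite sumEFin lee_fin.
rewrite integral_cst// [X in (_ * X)%E](probability_setT (seed_law A)).
by rewrite mule1.
Qed.

End Averaging.

Lemma is_opt_exists (R : realType) (T : finType) (f : {set T} -> R)
    (I : {set {set T}}) (S : {set T}) : S \in I -> exists O, is_opt f I O.
Proof.
move=> SI; case: (arg_maxP f SI) => O OI O_max.
by exists O; split=> // S' S'I; apply: O_max.
Qed.

(** * Concentration for a random transversal *)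

Section RandomTransversal.
Variables (R : realType) (M h : nat).
Implicit Types (c : {ffun 'I_M -> 'I_h}) (X : {set 'I_(M * h)}).

(* The ground set consists of M blocks of h elements; the transversal picks one
   element of each block, which makes its intersection with a fixed set a sum
   of independent indicators while its size is fixed. *)
Definition hidden_transversal c : {set 'I_(M * h)} :=
  [set mxvec_index i (c i) | i : 'I_M]%SET.

Lemma mxvec_index_inj (i i' : 'I_M) (j j' : 'I_h) :
  mxvec_index i j = mxvec_index i' j' -> i = i' /\ j = j'.
Proof.
have [g gK _] := curry_mxvec_bij M h.
move=> /(congr1 g); have /= := gK (i, j) isT; have /= := gK (i', j') isT.
by move=> -> -> [].
Qed.

Lemma transversal_inj c : injective (fun i => mxvec_index i (c i)).
Proof. by move=> i i' /mxvec_index_inj[]. Qed.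

Lemma card_hidden_transversal c : #|hidden_transversal c| = M.
Proof. by rewrite card_imset ?card_ord//; apply: transversal_inj. Qed.

Lemma card_setI_transversal c X :
  #|X :&: hidden_transversal c| = (\sum_i (mxvec_index i (c i) \in X))%N.
Proof.
rewrite -sum1_card big_mkcond /=.
rewrite (eq_bigr (fun e =>
    if e \in hidden_transversal c then (e \in X : nat) else 0%N)).
  by rewrite -big_mkcond big_imset //= => i i' _ _; apply: transversal_inj.
by move=> e _; rewrite inE; case: (e \in X); case: (e \in hidden_transversal c).
Qed.

Lemma sum_blocks X :
  (\sum_(i < M) \sum_(j < h) (mxvec_index i j \in X))%N = #|X|.
Proof.
rewrite pair_big /= -sum1_card [RHS]big_mkcond /=.
rewrite (reindex (uncurry (@mxvec_index M h))) /=.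
  by apply: eq_bigr => -[i j] _ /=; case: (_ \in _).
exact: curry_mxvec_bij.
Qed.

Hypothesis h_gt0 : (0 < h)%N.

(** Independence of the blocks appears as distributivity of the product over sums. A block with [s]
    points of [X] contributes [h + (exp lam - 1) s], bounded through [1 + x <= exp x]. *)
Lemma transversal_mgf (lam : R) X :
  0 <= lam ->
  \sum_c expR (lam * #|X :&: hidden_transversal c|%:R) <=
  (h ^ M)%:R * expR ((expR lam - 1) * (#|X|%:R / h%:R)).
Proof.
move=> lam_ge0; have h0 : (0 : R) < h%:R by rewrite ltr0n.
pose F i j := expR (lam * (mxvec_index i j \in X)%:R).
rewrite (eq_bigr (fun c : {ffun 'I_M -> 'I_h} => \prod_i F i (c i)));
  last first.
  move=> c _; rewrite card_setI_transversal natr_sum mulr_sumr.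
  by rewrite expR_sum.
rewrite -(bigA_distr_bigA F).
rewrite -sum_blocks natr_sum mulr_suml mulr_sumr expR_sum.
rewrite natrX -[X in _ ^+ X]card_ord -prodr_const -big_split /=.
apply: ler_prod => i _; rewrite sumr_ge0 => [/=|j _]; last exact: expR_ge0.
set s := (\sum_(j < h) _)%N.
have -> : \sum_j F i j = h%:R + (expR lam - 1) * s%:R.
  rewrite /s natr_sum mulr_sumr -[in h%:R](card_ord h) -sum1_card natr_sum.
  rewrite -big_split /=; apply: eq_bigr => j _; rewrite /F.
  by case: (_ \in _); rewrite ?mulr1 ?mulr0 ?expR0; ring.
apply: le_trans (_ : h%:R * (1 + (expR lam - 1) * (s%:R / h%:R)) <= _).
  by rewrite mulrDr mulr1 mulrCA (mulrCA h%:R) divff ?mulr1// lt0r_neq0.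
by rewrite ler_wpM2l ?expR_ge1Dx// ltW.
Qed.

(** From [exp x <= 1 / (1 - x)] and [(1 - x) (1 + x + 2 x^2) = 1 + x^2 (1 - 2 x) >= 1]. *)
Lemma expR_le_quadratic (x : R) :
  0 <= x -> x <= 1 / 2 -> expR x <= 1 + x + 2 * x ^+ 2.
Proof.
move=> x_ge0 x_small; have := expR_ge1Dx (- x); rewrite expRN => le_inv.
have e_gt0 := expR_gt0 x.
have : (1 - x) * expR x <= 1.
  by rewrite -ler_pdivlMr// mul1r.
nra.
Qed.

(** Chernoff bound: Markov's inequality for the exponential moment, with mean [s <= M] and
    [exp lam - 1 - lam <= 2 lam^2]. *)
Lemma transversal_tail (lam d : R) X :
  0 <= lam -> lam <= 1 / 2 ->
  #|[set c | #|X|%:R / h%:R + d <= #|X :&: hidden_transversal c|%:R]%SET|%:R <=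
  (h ^ M)%:R * expR (2 * lam ^+ 2 * M%:R - lam * d).
Proof.
move=> lam_ge0 lam_small; have h0 : (0 : R) < h%:R by rewrite ltr0n.
set s : R := #|X|%:R / h%:R.
have sM : s <= M%:R.
  rewrite /s ler_pdivrMr// -natrM ler_nat.
  by rewrite (leq_trans (max_card _))// card_ord.
have s_ge0 : 0 <= s by rewrite divr_ge0.
rewrite -(ler_pM2r (expR_gt0 (lam * (s + d)))) -[leRHS]mulrA -expRD.
apply: (@le_trans _ _ (\sum_c expR (lam * #|X :&: hidden_transversal c|%:R))).
  rewrite -sum1_card natr_sum mulr_suml big_mkcond /=.
  apply: ler_sum => c _; rewrite inE.
  case: ifP => [big|_]; last exact: expR_ge0.
  by rewrite mul1r ler_expR ler_wpM2l.
apply: le_trans (transversal_mgf _ lam_ge0) _.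
rewrite ler_wpM2l// ler_expR -/s.
have := expR_le_quadratic lam_ge0 lam_small.
have := sqr_ge0 lam.
nra.
Qed.

End RandomTransversal.

(** * Exponentials outgrow polynomials *)

Lemma horner_nat_le (p : {poly nat}) :
  exists K d, forall n, (0 < n)%N -> ((p.[n]%R).+1 <= K * n ^ d)%N.
Proof.
exists (\sum_(i < size p) (p`_i)%R).+1%N, (size p) => n n_gt0.
have pow i : (i <= size p)%N -> (n ^ i <= n ^ size p)%N by apply: leq_pexp2l.
rewrite mulSn -add1n leq_add ?expn_gt0 ?n_gt0//.
rewrite horner_coef big_distrl /=; apply: leq_sum => i _.
by rewrite leq_mul// natrXE pow// ltnW.
Qed.

Lemma expR_dominates_poly (R : realType) (p : {poly nat}) (u v w : nat) :
  (0 < u)%N -> (0 < v)%N -> (0 < w)%N ->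
  exists2 L, (0 < L)%N &
    ((p.[(u * L)%N]%R).+1 * v)%:R <= expR (L%:R / w%:R : R).
Proof.
move=> u0 v0 w0; have [K [d Kd]] := horner_nat_le p.
pose we := (w * d.+1)%N.
(* Chosen so that [L^(d+1) = K (u L)^d v we^(d+1)]. *)
pose L := (K * u ^ d * v * we ^ d.+1)%N.
have K0 : (0 < K)%N by move: (Kd 1%N isT); rewrite exp1n; lia.
have we0 : (0 < we)%N by rewrite muln_gt0 w0.
have L0 : (0 < L)%N by rewrite !muln_gt0 !expn_gt0 K0 u0 v0 we0.
exists L => //.
have weR : (0 : R) < we%:R by rewrite ltr0n.
(* [exp y >= y] at [y = L / we], raised to the power [d + 1]. *)
apply: (@le_trans _ _ ((L%:R / we%:R : R) ^+ d.+1)); last first.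
  have -> : L%:R / w%:R = d.+1%:R * (L%:R / we%:R) :> R.
    rewrite /we natrM invfM [RHS]mulrCA [X in _ = _ * X]mulrCA.
    by rewrite divff ?pnatr_eq0 ?mulr1.
  rewrite expRM_natl lerXn2r ?nnegrE ?expR_ge0 ?divr_ge0//.
  by apply: le_trans (expR_ge1Dx _); rewrite lerDr.
rewrite expr_div_n ler_pdivlMr ?exprn_gt0// -!natrX -natrM ler_nat.
have := Kd (u * L)%N; rewrite muln_gt0 u0 L0 => /(_ isT) pK.
have -> : (L ^ d.+1 = K * (u * L) ^ d * v * we ^ d.+1)%N.
  by rewrite expnS {1}/L expnMn; ring.
by rewrite !leq_mul2r pK !orbT.
Qed.

(** * Parameters of the hard family *)

Section HiddenFamily.
Variables (R : realType) (k r L : nat).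
Hypotheses (k_gt0 : (0 < k)%N) (r_gt0 : (0 < r)%N) (L_gt0 : (0 < L)%N).

(** The accuracy: errors are of order [1 / scale]. With it fixed, the threshold [L] grows to make
    concentration effective. *)
Definition scale : nat := (k * r)%N.
Definition numblocks : nat := (scale * L)%N.
(** Half of it minus 1 is [D^2 + 2]: a set that is not heavy but has more than [L] hidden points has
    at least [(D^2 + 2) L] others. *)
Definition blocksize : nat := (2 * scale ^ 2 + 6)%N.
(** This is [M / k + L]; the extra [L] pays for the hidden elements charged in full. *)
Definition budget : nat := (r.+1 * L)%N.
Definition rate : R := expR (- numblocks%:R^-1).
Definition residual_floor : R := expR (- scale%:R).

Local Notation D := scale.
Local Notation M := numblocks.
Local Notation h := blocksize.
Local Notation ground := 'I_(M * h).
Local Notation value := (@hidden_value R ground rate residual_floor L).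
Local Notation system := (@hidden_system ground k L budget).

Lemma scale_gt0 : (0 < D)%N. Proof. by rewrite muln_gt0 k_gt0. Qed.

Lemma numblocks_gt0 : (0 < M)%N. Proof. by rewrite muln_gt0 scale_gt0. Qed.

Lemma rate_ge0 : 0 <= rate. Proof. exact: expR_ge0. Qed.

Lemma rate_le1 : rate <= 1.
Proof. by rewrite /rate expR_le1 oppr_le0 invr_ge0. Qed.

Lemma residual_floor_ge0 : 0 <= residual_floor. Proof. exact: expR_ge0. Qed.

Lemma residual_floor_le : residual_floor <= D%:R^-1.
Proof.
rewrite /residual_floor expRN lef_pV2 ?posrE ?expR_gt0 ?ltr0n ?scale_gt0//.
by apply: le_trans (expR_ge1Dx _); rewrite lerDr.
Qed.

Lemma residual_floor_le1 : residual_floor <= 1.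
Proof. by rewrite /residual_floor expR_le1 oppr_le0. Qed.

(** Equivalently [1 / (M + 1) <= 1 - rate <= 1 / M], from [1 + x <= exp x] at [x = - 1 / M] and
    [x = 1 / M]. *)
Lemma rate_bounds : M%:R - 1 <= rate * M%:R /\ rate * (M%:R + 1) <= M%:R.
Proof.
have M0 : (0 : R) < M%:R by rewrite ltr0n numblocks_gt0.
have MV : M%:R^-1 * M%:R = 1 :> R by rewrite mulVf ?gt_eqF.
split.
  have := expR_ge1Dx (- M%:R^-1 : R); rewrite -/rate => lb.
  have := ler_wpM2r (ltW M0) lb; rewrite mulrDl mulNr MV; lra.
have := expR_ge1Dx (M%:R^-1 : R) => ub.
have rate0 : 0 < rate by apply: expR_gt0.
have : rate * expR (M%:R^-1) = 1 by rewrite /rate -expRD addNr expR0.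
have := ler_wpM2l (ltW (mulr_gt0 rate0 M0)) ub.
have -> : rate * M%:R * (1 + M%:R^-1) = rate * (M%:R + 1 * (M%:R^-1 * M%:R)).
  by ring.
by rewrite MV [leRHS]mulrAC => + e1; rewrite e1 !mul1r.
Qed.

Lemma rate_card (H : {set ground}) :
  (#|H| <= M)%N -> (1 - rate) *+ #|H| <= 1.
Proof.
move=> HM; apply: le_trans (_ : (1 - rate) *+ M <= 1).
  by apply: ler_wpMn2l; rewrite ?subr_ge0 ?rate_le1.
by rewrite -mulr_natr mulrBl mul1r; have [lb _] := rate_bounds; lra.
Qed.

Lemma valid_hidden (H : {set ground}) :
  (#|H| <= M)%N -> valid_instance k (value H) (system H).
Proof.
move=> HM; apply: hidden_instance_valid => //.
- exact: rate_ge0.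
- exact: rate_le1.
- exact: residual_floor_ge0.
- exact: residual_floor_le1.
- exact: rate_card.
Qed.

Lemma mem_hidden_set (H : {set ground}) : #|H| = M -> H \in system H.
Proof.
move=> HM; rewrite inE /hidden_weight setIid setDv cards0 HM /budget.
by rewrite /M /D; nia.
Qed.

(** The residual before truncation is at most [1 - (M - L) / (M + 1) = (L + 1) / (M + 1) <= 2 L / M
    = 2 / D]. *)
Lemma value_hidden_set (H : {set ground}) :
  #|H| = M -> 1 - 2 / D%:R <= value H H.
Proof.
move=> HM; rewrite /hidden_value lerB// ge_max.
have D0 : (0 : R) < D%:R by rewrite ltr0n scale_gt0.
have L0 : (1 : R) <= L%:R by rewrite ler1n.
have M0 : (0 : R) < M%:R by rewrite ltr0n numblocks_gt0.
have ME : M%:R = D%:R * L%:R :> R by rewrite natrM.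
apply/andP; split.
  apply: le_trans residual_floor_le _.
  by have : (0 : R) < D%:R^-1; [rewrite invr_gt0|lra].
rewrite /residual setIid setDv cards0 expr0 mulr1 HM /decay.
have LM : (L <= M)%N by rewrite leq_pmull// scale_gt0.
have [lb ub] := rate_bounds.
have le1 := rate_le1.
rewrite -mulr_natr natrB//.
have gain_ge0 : 0 <= 1 - (1 - rate) * (M%:R - L%:R) by nra.
apply: (@le_trans _ _ (1 - (1 - rate) * (M%:R - L%:R))).
  by rewrite ler_piMl// exprn_ile1 ?rate_ge0.
rewrite ler_pdivlMr//.
rewrite -(ler_pM2r (lt_le_trans ltr01 L0)) -(mulrA _ D%:R) -ME.
have : M%:R - L%:R <= (1 - rate) * (M%:R - L%:R) * (M%:R + 1).
  have : (L%:R : R) <= M%:R by rewrite ler_nat.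
  by nra.
by nra.
Qed.

Lemma value_budget (S : {set ground}) :
  S \in system set0 ->
  value set0 S <= 1 - expR (- (1 / k%:R)) + D%:R^-1.
Proof.
have k0 : (0 : R) < k%:R by rewrite ltr0n.
have r0 : (0 : R) < r%:R by rewrite ltr0n.
have L0 : (0 : R) < L%:R by rewrite ltr0n.
rewrite mem_hidden_system_set0// => S_small.
rewrite /hidden_value residual_set0.
have : rate ^+ budget <= Num.max residual_floor (rate ^+ #|S|).
  by rewrite le_max ler_wiXn2l ?orbT ?rate_ge0 ?rate_le1.
(* The exponent is [(r + 1) L / M = 1 / k + 1 / D]; the second factor costs at most [1 / D]. *)
have -> : rate ^+ budget = expR (- (1 / k%:R)) * expR (- D%:R^-1).
  rewrite /rate -expRM_natl -expRD; congr expR.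
  rewrite /budget /M /D !natrM -natr1; field.
  by rewrite !gt_eqF.
have := expR_ge1Dx (- D%:R^-1 : R).
have : expR (- (1 / k%:R) : R) <= 1.
  by rewrite expR_le1 oppr_le0 divr_ge0.
have := expR_gt0 (- (1 / k%:R) : R).
have : (0 : R) < D%:R^-1 by rewrite invr_gt0 ltr0n scale_gt0.
by move: (D%:R^-1) (expR _) (expR _) (Num.max _ _) => a b c d; nra.
Qed.

Definition heavy (c : {ffun 'I_M -> 'I_h}) (X : {set ground}) : bool :=
  #|X|%:R / h%:R + L%:R / 2 <= #|X :&: hidden_transversal c|%:R :> R.

Lemma not_heavy_indistinguishable c X : ~~ heavy c X ->
  value (hidden_transversal c) X = value set0 X /\
  (X \in system (hidden_transversal c)) = (X \in system set0).
Proof.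
have h0 : (0 : R) < h%:R by rewrite ltr0n /h addn_gt0 orbT.
rewrite /heavy -ltNge => light; apply: hidden_instance_eq_set0;
  rewrite ?rate_ge0 ?rate_le1 ?residual_floor_ge0 ?residual_floor_le1//.
move=> Lx; have cX := cardsID (hidden_transversal c) X.
have {}light : (2 * h * #|X :&: hidden_transversal c| < 2 * #|X| + h * L)%N.
  move: light; rewrite -(ltr_pM2l h0) mulrDr mulrCA divff ?gt_eqF// mulr1.
  move=> light.
  by rewrite -(ltr_nat R) !natrD !natrM; lra.
move: (#|X :&: _|) (#|X :\: _|) cX light Lx => x y <- light Lx.
have y_large : ((D ^ 2 + 2) * L <= y)%N.
  have hE : h = (2 * (D ^ 2 + 2) + 2)%N by rewrite /h; lia.
  move: light; rewrite hE; move: (D ^ 2 + 2)%N => g light.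
  have : (g * L <= g * x)%N by rewrite leq_mul2l (ltnW Lx) orbT.
  by lia.
have rD : (r <= D ^ 2)%N.
  by rewrite (leq_trans (leq_pmull r k_gt0))// leq_pmulr// scale_gt0.
split; first by rewrite (leq_trans _ y_large)// ltn_mul2r L_gt0 /=; lia.
(* [residual_floor] is this power of [rate], and [D M = D^2 L <= y]. *)
apply: (@le_trans _ _ (rate ^+ (D * M))).
  by rewrite ler_wiXn2l ?rate_ge0 ?rate_le1// /M; nia.
rewrite /rate -expRM_natl natrM mulrN -mulrA divff ?mulr1//.
by rewrite pnatr_eq0 -lt0n numblocks_gt0.
Qed.

(** The deviation [L / 2] is the fraction [1 / (2 D)] of [M], so the exponent is linear in [L] for
    fixed [D]. *)
Lemma heavy_rare X :
  #|[set c | heavy c X]%SET|%:R <=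
  (h ^ M)%:R * expR (- (L%:R / (32 * D)%:R)) :> R.
Proof.
have h0 : (0 < h)%N by rewrite /h addn_gt0 orbT.
have D0 : (1 : R) <= D%:R by rewrite ler1n scale_gt0.
have D0' : (0 : R) < D%:R by lra.
(* The minimiser of [2 lam^2 M - lam L / 2]. *)
pose lam : R := (8 * D%:R)^-1.
have lam0 : 0 <= lam by rewrite invr_ge0; lra.
have lam2 : lam <= 1 / 2 by rewrite div1r lef_pV2 ?posrE; lra.
apply: le_trans (transversal_tail h0 (L%:R / 2) X lam0 lam2) _.
rewrite ler_wpM2l// ler_expR /lam /M !natrM.
rewrite le_eqVlt; apply/orP; left; apply/eqP; field.
by rewrite !pnatr_eq0 -!lt0n r_gt0.
Qed.

(** The run on the reference instance fixes [q + 1] sets; unless one of them is heavy, the output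
    has at most the value allowed by [value_budget]. *)
Lemma sum_expected_hidden_le (A : rand_algorithm R ground) (q : nat) :
  (forall w : seed A,
     query_count (strategy w) (value set0) (system set0) <= q)%N ->
  (forall w : seed A,
     run (strategy w) (value set0) (system set0) \in system set0) ->
  (\sum_(c : {ffun 'I_M -> 'I_h})
     expected_value A (value (hidden_transversal c))
       (system (hidden_transversal c)) <=
   ((h ^ M)%:R * (1 - expR (- (1 / k%:R)) + D%:R^-1 +
      q.+1%:R * expR (- (L%:R / (32 * D)%:R))))%:E)%E.
Proof.
move=> few_queries indep.
have valid c := valid_hidden (eq_leq (@card_hidden_transversal M h c)).
apply: sum_expected_value_le => [c|w]; first by have [] := valid c.
apply: le_trans (sum_run_indistinguishable (differ := heavy)
  not_heavy_indistinguishable heavy_rare _ _ (value_budget (indep w))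
  (few_queries w)) _.
- by move=> c X; apply: hidden_value_le1; apply: residual_floor_ge0.
- rewrite addr_ge0 ?invr_ge0// subr_ge0 expR_le1 oppr_le0 divr_ge0//.
- by rewrite card_ffun !card_ord [X in _ <= X]mulrDr [X in _ + X <= _]mulrCA.
Qed.

(** Each hidden transversal is feasible, so every optimum is at least [1 - 2 / D]. *)
Lemma sum_expected_hidden_ge (A : rand_algorithm R ground) (alpha : R) :
  0 < alpha ->
  (forall f I, valid_instance k f I -> forall OPT, is_opt f I OPT ->
     ((f OPT / alpha)%:E <= expected_value A f I)%E) ->
  (((h ^ M)%:R * ((1 - 2 / D%:R) / alpha))%:E <=
   \sum_(c : {ffun 'I_M -> 'I_h})
     expected_value A (value (hidden_transversal c))
       (system (hidden_transversal c)))%E.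
Proof.
move=> alpha_gt0 approx.
have -> : (((h ^ M)%:R * ((1 - 2 / D%:R) / alpha))%:E =
    \sum_(c : {ffun 'I_M -> 'I_h}) ((1 - 2 / D%:R) / alpha)%:E :> \bar R)%E.
  by rewrite sumEFin sumr_const card_ffun !card_ord mulr_natl.
apply: lee_sum => c _; have cardH := @card_hidden_transversal M h c.
have [OPT OPT_max] := is_opt_exists (value (hidden_transversal c))
  (mem_hidden_set cardH).
apply: le_trans (approx _ _ (valid_hidden (eq_leq cardH)) _ OPT_max).
rewrite lee_fin ler_wpM2r ?invr_ge0 ?(ltW alpha_gt0)//.
apply: le_trans (value_hidden_set cardH) _.
by have [_ ->//] := OPT_max; apply: mem_hidden_set.
Qed.

End HiddenFamily.

(** * The contradiction *)

Lemma natr_large_multiple (R : realType) (k : nat) (x : R) :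
  (0 < k)%N -> exists2 r, (0 < r)%N & x < (k * r)%:R.
Proof.
move=> k_gt0; exists (Num.bound `|x|).+1 => //.
apply: le_lt_trans (ler_norm x) _.
apply: lt_le_trans (archi_boundP (normr_ge0 x)) _.
by rewrite ler_nat (leq_trans (leqnSn _))// leq_pmull.
Qed.

Theorem theorem44 (R : realType) (k : nat) (eps : R) :
  (0 < k)%N -> 0 < eps ->
  ~ exists A : algorithm R,
      [/\ polynomial_queries k A, outputs_independent k A
        & approximation_ratio k A ((1 - expR (- (1 / k%:R)))^-1 - eps)].
Proof.
move=> k_gt0 eps_gt0 [A [[p few_queries] indep [alpha_gt0 approx]]].
set beta := 1 - expR (- (1 / k%:R)) in alpha_gt0 approx.
set alpha := beta^-1 - eps in alpha_gt0 approx.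
have beta_gt0 : 0 < beta.
  by rewrite subr_gt0 expR_lt1 oppr_lt0 divr_gt0 ?ltr0n.
(* Makes [eps * beta * D] exceed [2 + 2 * alpha], the total error after scaling by [D]. *)
have [r r_gt0 r_large] :=
  natr_large_multiple ((2 + 2 * alpha) / (eps * beta)) k_gt0.
pose D := scale k r; pose h := blocksize k r.
have D_gt0 : (0 < D)%N by apply: scale_gt0.
have h_gt0 : (0 < h)%N by rewrite /h /blocksize addn_gt0 orbT.
(* With [D] and [h] fixed, the ground set size [D * h * L] is linear in [L], and the union bound
   term drops to [1 / D]. *)
have [L L_gt0 L_large] :
    exists2 L, (0 < L)%N &
      ((p.[(D * h * L)%N]%R).+1 * D)%:R <= expR (L%:R / (32 * D)%:R : R).
  by apply: expR_dominates_poly => //; rewrite muln_gt0 D_gt0.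
pose n := (numblocks k r L * h)%N.
have nE : (D * h * L)%N = n by rewrite /n /numblocks -/D mulnAC.
have valid0 := @valid_hidden R k r L k_gt0 r_gt0 L_gt0 set0 _.
have {}valid0 := valid0 (leq_trans (eq_leq (cards0 _)) (leq0n _)).
have ub := sum_expected_hidden_le k_gt0 r_gt0 L_gt0 (A := A n)
  (few_queries _ _ _ valid0) (indep _ _ _ valid0).
have lb := sum_expected_hidden_ge k_gt0 r_gt0 L_gt0 alpha_gt0 (approx n).
have := le_trans lb ub; rewrite lee_fin ler_pM2l; last first.
  by rewrite ltr0n expn_gt0 h_gt0.
rewrite -/beta -/D ler_pdivrMr// => bad.
have D0 : (0 : R) < D%:R by rewrite ltr0n.
have fail : (p.[n]%R).+1%:R * expR (- (L%:R / (32 * D)%:R)) <= D%:R^-1 :> R.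
  move: L_large; rewrite nE natrM => L_large.
  rewrite expRN ler_pdivrMr ?expR_gt0// mulrC ler_pdivlMr//.
move: r_large; rewrite ltr_pdivrMr ?mulr_gt0// -[(k * r)%N]/D => r_large.
have ab : alpha * beta = 1 - eps * beta.
  by rewrite /alpha mulrBl mulVf ?gt_eqF.
have {bad}fail : 1 - 2 / D%:R <= (beta + D%:R^-1 + D%:R^-1) * alpha.
  by apply: (le_trans bad); rewrite ler_pM2r// lerD2l.
have DV : D%:R^-1 * D%:R = 1 :> R by rewrite mulVf ?gt_eqF.
(* Multiplied by [D] this reads [D - 2 <= (1 - eps * beta) * D + 2 * alpha], against the choice of
   [r]. *)
have := ler_wpM2r (ltW D0) fail.
have -> : (1 - 2 / D%:R) * D%:R = D%:R - 2 * (D%:R^-1 * D%:R) :> R by ring.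
have -> : (beta + D%:R^-1 + D%:R^-1) * alpha * D%:R =
    alpha * beta * D%:R + 2 * alpha * (D%:R^-1 * D%:R) by ring.
by rewrite DV ab; lra.
Qed.
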